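(* Let $\mathfrak C$ be a left cancellative small category. The canonical projection $I_l\ltimes\Omega\twoheadrightarrow I_l\,\bar\ltimes\,\Omega$ is an isomorphism (of topological groupoids) if one of the following holds: (i) $\mathfrak C$ is finitely aligned. (ii) $I_l\ltimes\Omega$ is Hausdorff.
   Context: $\mathfrak C$ denotes the set of morphisms, $\mathfrak C^0\subseteq\mathfrak C$ the identity morphisms, $\mathfrak d,\mathfrak t$ domain and target; $cd$ is defined iff $\mathfrak d(c)=\mathfrak t(d)$; left cancellative means $cx=cy\Rightarrow x=y$. $\mathfrak C$ is finitely aligned if for all $a,b\in\mathfrak C$ there is a finite $F\subseteq\mathfrak C$ with $a\mathfrak C\cap b\mathfrak C=\bigcup_{c\in F}c\mathfrak C$. Each $c\in\mathfrak C$ gives the partial bijection $\mathfrak d(c)\mathfrak C\to c\mathfrak C$, $x\mapsto cx$; $I_l$ is the smallest semigroup of partial bijections of $\mathfrak C$ containing these and closed under inverses; $\mathcal J=\{\mathrm{dom}(s):s\in I_l\}$ is its semilattice of idempotents (product = intersection). $\bar{\mathcal J}$ is the set of subsets $\varepsilon=e\setminus\bigcup_{i=1}^nf_i$ with $e,f_i\in\mathcal J$, $f_i\subseteq e$. $\widehat{\mathcal J}$ is the space of non-zero multiplicative maps $\chi:\mathcal J\to\{0,1\}$ with $\chi(\emptyset)=0$ if $\emptyset\in\mathcal J$ (pointwise convergence). $\Omega\subseteq\widehat{\mathcal J}$ consists of those $\chi$ such that whenever $e=\bigcup_{i=1}^nf_i$ ($e,f_i\in\mathcal J$) and $\chi(e)=1$,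 then $\chi(f_i)=1$ for some $i$. For $\chi\in\Omega$, $\varepsilon=e\setminus\bigcup f_i\in\bar{\mathcal J}$, put $\chi(\varepsilon)=1$ iff $\chi(e)=1$ and all $\chi(f_i)=0$, and $\chi(\varepsilon)=0$ otherwise. $s\in I_l$ acts by $\chi\mapsto s.\chi=\chi(s^{-1}\cdot s)$ from $\Omega(s^{-1}s)=\{\chi\in\Omega:\chi(s^{-1}s)=1\}$ onto $\Omega(ss^{-1})$. $I_l\ltimes\Omega$ is the quotient of $\{(s,\chi)\in I_l\times\Omega:\chi(s^{-1}s)=1\}$ by $(s,\chi)\sim(t,\psi)$ iff $\chi=\psi$ and $se=te$ for some $e\in\mathcal J$ with $\chi(e)=1$; $I_l\,\bar\ltimes\,\Omega$ is the quotient by $(s,\chi)\bar\sim(t,\psi)$ iff $\chi=\psi$ and $s\varepsilon=t\varepsilon$ for some $\varepsilon\in\bar{\mathcal J}$ with $\chi(\varepsilon)=1$ ($se$, $s\varepsilon$ denote restrictions as partial bijections). Both are groupoids with source $\chi$, range $s.\chi$, $[s,t.\chi][t,\chi]=[st,\chi]$; in both cases the topology is such that the images of $\{s\}\times\Omega(s^{-1}s)$ are open and mapped homeomorphically onto $\Omega(s^{-1}s)$ by the source map. The canonical projection sends the $\sim$-class of $(s,\chi)$ to its $\bar\sim$-class. *)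

(* Defs.v *)
From HB Require Import structures.
From mathcomp Require Import all_boot.
From mathcomp Require Import all_classical.
From mathcomp Require Import topology.

Set Implicit Arguments.
Unset Strict Implicit.
Unset Printing Implicit Defensive.

Local Open Scope classical_set_scope.
Local Open Scope relation_scope.
Local Open Scope quotient_scope.

(* [comp c d] is the composite "c after d"; it is total for convenience and
   its value is irrelevant unless [dom c = cod d]. *)
Record is_category (Ob Mor : Type) (dom cod : Mor -> Ob) (idm : Ob -> Mor)
    (comp : Mor -> Mor -> Mor) : Prop := IsCategory {
  dom_idm : forall x, dom (idm x) = x;
  cod_idm : forall x, cod (idm x) = x;
  dom_comp : forall c d, dom c = cod d -> dom (comp c d) = dom d;
  cod_comp : forall c d, dom c = cod d -> cod (comp c d) = cod c;
  comp_idl : forall c, comp (idm (cod c)) c = c;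
  comp_idr : forall c, comp c (idm (dom c)) = c;
  compA : forall b c d, dom b = cod c -> dom c = cod d ->
    comp b (comp c d) = comp (comp b c) d }.

(* Objects correspond to identity morphisms through the injection [idm]. *)
Record smallCategory := SmallCategory {
  obj : Type;
  mor :> Type;
  dom : mor -> obj;
  cod : mor -> obj;
  idm : obj -> mor;
  comp : mor -> mor -> mor;
  smallCategoryP : is_category dom cod idm comp }.

Definition left_cancellative (C : smallCategory) := forall c x y : C,
  dom c = cod x -> dom c = cod y -> comp c x = comp c y -> x = y.

Record lcCategory := LcCategory {
  lcCategory_cat :> smallCategory;
  lcCategoryP : left_cancellative lcCategory_cat }.

(* the set cC *)
Definition right_ideal (C : smallCategory) (c : C) : set C :=
  [set comp c x | x in [set x | dom c = cod x]].

Definition finitely_aligned (C : smallCategory) := forall a b : C,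
  exists2 F : set C, finite_set F &
    right_ideal a `&` right_ideal b = \bigcup_(c in F) right_ideal c.

(* Partial bijections are represented by their graphs: [s \; t] is the composite
   "s after t" and [s^-1] is the inverse of [s]. *)

Section PartialBijections.
Variable T : Type.
Implicit Types (s t : set (T * T)) (A : set T).

Definition partial_bijection s :=
  (forall x y z, s (x, y) -> s (x, z) -> y = z) /\
  (forall x y z, s (x, z) -> s (y, z) -> x = y).

Definition pdom s : set T := [set x | exists y, s (x, y)].

Definition ppreimage s A : set T := [set x | exists2 y, s (x, y) & A y].

Definition prestrict s A : set (T * T) := [set p | s p /\ A p.1].

End PartialBijections.

Definition lmul (C : smallCategory) (c : C) : set (C * C) :=
  [set p | dom c = cod p.1 /\ p.2 = comp c p.1].

Inductive left_inverse_hull (C : smallCategory) : set (C * C) -> Prop :=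
| lih_lmul c : left_inverse_hull (lmul c)
| lih_inv s : left_inverse_hull s -> left_inverse_hull s^-1
| lih_comp s t : left_inverse_hull s -> left_inverse_hull t ->
    left_inverse_hull (s \; t).

(* the inverse semigroup I_l *)
Definition Il (C : smallCategory) : set (set (C * C)) :=
  [set s | left_inverse_hull s].
Arguments Il C : clear implicits.

(* the semilattice J *)
Definition Jl (C : smallCategory) : set (set C) := [set pdom s | s in Il C].
Arguments Jl C : clear implicits.

Lemma Il_partial_bijection (C : lcCategory) (s : Il C) :
  partial_bijection (\val s).
Proof.
case: s => s /= /set_mem; elim=> {s}.
- move=> c; split=> [x y z [_ /= ->] [_ /= ->] //|x y z [/= cx ->] [/= cy]].
  exact: lcCategoryP.
- by move=> s _ [sf si]; split=> x y z; [apply: si|apply: sf].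
- move=> s t _ [sf si] _ [tf ti]; split=> x y z [u /= + +] [v /=].
  + move=> txu suy txv svz; move: svz; rewrite -(tf _ _ _ txu txv).
    exact: sf.
  + move=> txu suz tyv svz; move: tyv; rewrite -(si _ _ _ suz svz).
    exact: ti.
Qed.

Section Semilattice.
Variable C : lcCategory.
Implicit Types (s t : Il C) (e f : Jl C).

Definition il_inv s : Il C := SigSub (mem_set (lih_inv (set_valP s))).
Definition il_comp s t : Il C :=
  SigSub (mem_set (lih_comp (set_valP s) (set_valP t))).

(* the idempotent s^-1 s, idempotents being identified with their domains *)
Definition jdom s : Jl C :=
  SigSub (mem_set (ex_intro2 _ _ (\val s) (set_valP s) erefl)).

Lemma Jl_meet e f : Jl C (\val e `&` \val f).
Proof.
case: (set_valP e) (set_valP f) => s Is se [t It te].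
exists (s \; (t^-1 \; t)); first by do !constructor.
rewrite -se -te; have [_ ti] := @Il_partial_bijection C (SigSub (mem_set It)).
apply/seteqP; split=> x /=.
  by move=> [y [z [u /= xu zu] zy]]; rewrite (ti _ _ _ xu zu); split;
    [exists y|exists u; rewrite -?(ti _ _ _ xu zu)].
by move=> [[y xy] [z xz]]; exists y, x => //; exists z.
Qed.

Definition jmeet e f : Jl C := SigSub (mem_set (Jl_meet e f)).

Lemma Jl_preimage s e : Jl C (ppreimage (\val s) (\val e)).
Proof.
case: (set_valP e) => t It te; exists (t \; \val s).
  by constructor => //; exact: set_valP.
rewrite -te; apply/seteqP; split=> x /=.
  by move=> [y [z /= sxz tzy]]; exists z => //; exists y.
by move=> [z sxz [y tzy]]; exists y, z.
Qed.

(* the idempotent s^-1 e s *)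
Definition jpreimage s e : Jl C := SigSub (mem_set (Jl_preimage s e)).

Lemma Il_id e : Il C [set p | p.1 = p.2 /\ \val e p.1].
Proof.
case: (set_valP e) => s Is se.
rewrite (_ : [set _ | _] = s^-1 \; s); first by do !constructor.
have [_ si] := @Il_partial_bijection C (SigSub (mem_set Is)).
rewrite -se; apply/seteqP; split=> -[x y] /=.
  by move=> [<- [z xz]]; exists z.
by move=> [z xz yz]; split; [exact: si xz yz|exists z].
Qed.

(* [e] as an element of I_l *)
Definition il_id e : Il C := SigSub (mem_set (Il_id e)).

End Semilattice.

Section Characters.
Variable C : lcCategory.
Implicit Types (s t : Il C) (e f : Jl C).

Definition spectrum := [set chi : {ptws Jl C -> bool} |
  [/\ exists e, chi e,
      forall e f, chi (jmeet e f) = chi e && chi f &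
      forall e, \val e = set0 -> chi e = false]].

(* Finite families f_1, ..., f_n are given by finite sets [F]. *)
Definition Omega := [set chi : {ptws Jl C -> bool} | spectrum chi /\
  forall e (F : set (Jl C)), finite_set F ->
    \val e = \bigcup_(f in F) \val f -> chi e -> exists2 f, F f & chi f].

(* chi(s^-1 . s) *)
Definition act_fun s (chi : {ptws Jl C -> bool}) : {ptws Jl C -> bool} :=
  fun e => chi (jpreimage s e).

Lemma act_Omega s (chi : Omega) : \val chi (jdom s) ->
  Omega (act_fun s (\val chi)).
Proof.
case: chi => chi /= /set_mem [[chiN chiM chi0] chiU] chis.
have [sf si] := Il_partial_bijection s.
split; first split.
- exists (jdom (il_inv s)); rewrite /act_fun.
  suff -> : jpreimage s (jdom (il_inv s)) = jdom s by [].
  apply/val_inj/seteqP; split=> x /=; first by case=> y; exists y.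
  by case=> y xy; exists y => //; exists x.
- move=> e f; rewrite /act_fun -chiM; congr chi.
  apply/val_inj/seteqP; split=> x /=.
    by move=> [y xy [ey fy]]; split; exists y.
  move=> [[y xy ey] [z xz fz]]; exists y => //; split=> //.
  by rewrite (sf _ _ _ xy xz).
- move=> e e0; apply: chi0; apply/seteqP; split=> x //= -[y _].
  by rewrite e0.
- move=> e F finF eF chie.
  have [||f [g Fg <-] chif] := chiU (jpreimage s e) (jpreimage s @` F) _ _ chie.
  + exact: finite_image.
  + apply/seteqP; split=> x /=.
      rewrite /ppreimage/= => -[y xy]; rewrite eF => -[f Ff fy].
      by exists (jpreimage s f); [exists f|exists y].
    move=> [_ [f Ff <-] [y xy fy]]; exists y => //; rewrite eF.
    by exists f.
  + by exists g.
Qed.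

(* s.chi, for chi in Omega(s^-1 s) *)
Definition act s (chi : Omega) (H : \val chi (jdom s)) : Omega :=
  SigSub (mem_set (act_Omega H)).

(* the set of subsets e \ (f_1 u ... u f_n); n = 0 is allowed *)
Definition Jbar : set (set C) := [set A | exists e (F : set (Jl C)),
  [/\ finite_set F, forall f, F f -> \val f `<=` \val e &
      A = \val e `\` \bigcup_(f in F) \val f]].

(* chi(A) = 1, for A in Jbar: see [Jbar_evalE] for independence of the
   presentation of A *)
Definition Jbar_eval (chi : Omega) (A : set C) : Prop :=
  exists e (F : set (Jl C)),
  [/\ finite_set F, forall f, F f -> \val f `<=` \val e,
      A = \val e `\` \bigcup_(f in F) \val f,
      \val chi e & forall f, F f -> \val chi f = false].

Lemma Omega_meet (chi : Omega) e f :
  \val chi (jmeet e f) = \val chi e && \val chi f.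
Proof. by case: chi => chi /= /set_mem [[]]. Qed.

Lemma Omega_nonzero (chi : Omega) : exists e, \val chi e.
Proof. by case: chi => chi /= /set_mem [[]]. Qed.

Lemma Omega_sub (chi : Omega) e f :
  \val e `<=` \val f -> \val chi e -> \val chi f.
Proof.
move=> ef chie; suff : \val chi (jmeet e f) by rewrite Omega_meet => /andP[].
by rewrite (_ : jmeet e f = e)//; apply/val_inj/setIidPl.
Qed.

Lemma Jbar_eval_cover (chi : Omega) A d (G : set (Jl C)) :
  Jbar_eval chi A -> finite_set G ->
  A `&` \val d `<=` \bigcup_(g in G) \val g ->
  \val chi d -> exists2 g, G g & \val chi g.
Proof.
move=> [e [F [finF _ -> chie chiF]]] finG AdG chid.
have /set_mem [_ chiU] := valP chi.
have chied : \val chi (jmeet e d) by rewrite Omega_meet chie chid.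
have [||_ [g FGg <-]] :=
  chiU (jmeet e d) (jmeet (jmeet e d) @` (F `|` G)) _ _ chied.
- by apply: finite_image; rewrite finite_setU.
- apply/seteqP; split=> x /=; last by move=> [_ [g _ <-] []].
  move=> [ex dx].
  suff [g FGg gx] : exists2 g, (F `|` G) g & \val g x.
    by exists (jmeet (jmeet e d) g) => //; exists g.
  have [[f Ff fx]|nFx] := pselect ((\bigcup_(f in F) \val f) x).
    by exists f; [left|].
  by have [] := AdG x => // g Gg gx; exists g; [right|].
- rewrite Omega_meet => /andP[_ chig]; exists g => //.
  by case: FGg => // /chiF; rewrite chig.
Qed.

Lemma Jbar_evalE (chi : Omega) e (F : set (Jl C)) :
  finite_set F -> (forall f, F f -> \val f `<=` \val e) ->
  Jbar_eval chi (\val e `\` \bigcup_(f in F) \val f) <->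
  \val chi e /\ forall f, F f -> \val chi f = false.
Proof.
move=> finF Fe; split=> [chiA|[chie chiF]]; last by exists e, F.
have [d chid] := Omega_nonzero chi; split.
  have [||g -> //] := Jbar_eval_cover (G := [set e]) chiA _ _ chid.
    exact: finite_set1.
  by move=> x [[ex _] _]; exists e.
move=> f Ff; apply/negbTE/negP => chif.
have [||g //] := Jbar_eval_cover (G := set0) chiA _ _ chif.
  exact: finite_set0.
by move=> x [[_ nFx] fx]; case: nFx; exists f.
Qed.

Lemma Omega_eval_near (chi : Omega) e :
  \forall psi \near chi, \val psi e = \val chi e.
Proof.
have := @proj_continuous {classic Jl C} (fun=> bool) e (\val chi).
have := @initial_continuous Omega {ptws Jl C -> bool} set_val chi.
rewrite set_valE => vc pc.
have := cvg_comp _ _ vc pc.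
move=> /(_ [set \val chi e]); apply; exact: discrete_set1.
Qed.

Lemma Jbar_eval_near (chi : Omega) A :
  Jbar_eval chi A -> \forall psi \near chi, Jbar_eval psi A.
Proof.
move=> [e [F [finF Fe -> chie chiF]]].
have nF : \forall psi \near chi, forall f, F f -> \val psi f = false.
  suff : nbhs chi (\bigcap_(f in F) [set psi | \val psi f = \val chi f]).
    by apply: filterS => psi psiF f Ff; rewrite psiF ?chiF.
  rewrite -(fset_setK finF); apply: filter_bigI => f _.
  exact: Omega_eval_near.
near=> psi; apply/Jbar_evalE => //; split; last by near: psi.
by rewrite (near (Omega_eval_near chi e) psi).
Unshelve. all: by end_near. Qed.

Lemma Jbar_evalI (chi : Omega) A B :
  Jbar_eval chi A -> Jbar_eval chi B -> Jbar_eval chi (A `&` B).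
Proof.
move=> [e [F [finF Fe -> chie chiF]]] [d [G [finG Gd -> chid chiG]]].
exists (jmeet e d), (jmeet (jmeet e d) @` (F `|` G)); split.
- by apply: finite_image; rewrite finite_setU.
- by move=> _ [g _ <-] x [].
- apply/seteqP; split=> x /=.
    move=> [[ex nF] [dx nG]]; split=> // -[_ [g [Fg|Gg] <-] [_ gx]].
      by apply: nF; exists g.
    by apply: nG; exists g.
  move=> [[ex dx] nFG]; do !split=> //; move=> -[f Ff fx]; apply: nFG.
    by exists (jmeet (jmeet e d) f) => //; exists f => //; left.
  by exists (jmeet (jmeet e d) f) => //; exists f => //; right.
- by rewrite Omega_meet chie.
- by move=> _ [g [/chiF|/chiG] gF <-]; rewrite Omega_meet gF andbF.
Qed.

Lemma Jbar_eval_preimage s (chi : Omega) (H : \val chi (jdom s)) A :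
  Jbar_eval (act H) A -> Jbar_eval chi (ppreimage (\val s) A).
Proof.
move=> [e [F [finF Fe -> chie chiF]]]; have [sf _] := Il_partial_bijection s.
exists (jpreimage s e), (jpreimage s @` F); split => //.
- exact: finite_image.
- by move=> _ [f /Fe fe <-] x [y xy fy]; exists y => //; exact: fe.
- apply/seteqP; split=> x /=.
    move=> [y xy [ey nFy]]; split; first by exists y.
    move=> [_ [f Ff <-] [z xz fz]]; apply: nFy; exists f => //.
    by rewrite (sf _ _ _ xy xz).
  move=> [[y xy ey] nFx]; exists y => //; split=> // -[f Ff fy]; apply: nFx.
  by exists (jpreimage s f); [exists f|exists y].
- by move=> _ [f /chiF chif <-].
Qed.

End Characters.

Arguments spectrum C : clear implicits.
Arguments Omega C : clear implicits.
Arguments Jbar C : clear implicits.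

Record topGroupoid := TopGroupoid {
  units : topologicalType;
  arrows :> topologicalType;
  gsource : arrows -> units;
  grange : arrows -> units;
  unit_arrow : units -> arrows;
  gmul : arrows -> arrows -> arrows;
  ginv : arrows -> arrows;
  _ : is_category gsource grange unit_arrow gmul;
  _ : forall g, gsource (ginv g) = grange g;
  _ : forall g, grange (ginv g) = gsource g;
  _ : forall g, gmul (ginv g) g = unit_arrow (gsource g);
  _ : forall g, gmul g (ginv g) = unit_arrow (grange g);
  _ : continuous gsource;
  _ : continuous grange;
  _ : continuous unit_arrow;
  _ : {within [set p | gsource p.1 = grange p.2],
        continuous (fun p : arrows * arrows => gmul p.1 p.2)};
  _ : continuous ginv }.

Definition homeomorphism (X Y : topologicalType) (f : X -> Y) :=
  exists g : Y -> X, [/\ cancel f g, cancel g f, continuous f & continuous g].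

Record topGroupoid_isomorphism (G H : topGroupoid)
    (phi0 : units G -> units H) (phi : G -> H) : Prop :=
    TopGroupoidIsomorphism {
  iso_units : homeomorphism phi0;
  iso_arrows : homeomorphism phi;
  iso_source : forall g, gsource (phi g) = phi0 (gsource g);
  iso_range : forall g, grange (phi g) = phi0 (grange g);
  iso_unit : forall x, phi (unit_arrow x) = unit_arrow (phi0 x);
  iso_mul : forall g h, gsource g = grange h ->
    phi (gmul g h) = gmul (phi g) (phi h) }.

(* Both equivalence relations have the form: (s,chi) ~ (t,psi) iff chi = psi and
   s, t have the same restriction to some A in N(chi), where N(chi) is
   {e in J | chi(e) = 1}, respectively {A in Jbar | chi(A) = 1}. *)

Record germBase (C : lcCategory) := GermBase {
  germ_sets :> Omega C -> set (set C);
  germ_sets_J : forall (chi : Omega C) (e : Jl C),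
    \val chi e -> germ_sets chi (\val e);
  germ_setsI : forall (chi : Omega C) A B,
    germ_sets chi A -> germ_sets chi B -> germ_sets chi (A `&` B);
  germ_sets_sub : forall (chi : Omega C) A (e f : Jl C),
    germ_sets chi A -> A `&` \val e `<=` \val f -> \val chi e -> \val chi f;
  germ_sets_preimage : forall (s : Il C) (chi : Omega C)
    (H : \val chi (jdom s)) A,
    germ_sets (act H) A -> germ_sets chi (ppreimage (\val s) A);
  germ_sets_near : forall (chi : Omega C) A,
    germ_sets chi A -> \forall psi \near chi, germ_sets psi A }.

Section JGerms.
Variable C : lcCategory.

Definition J_germ_sets (chi : Omega C) : set (set C) :=
  [set \val e | e in [set e : Jl C | \val chi e]].

Definition Jbar_germ_sets (chi : Omega C) : set (set C) :=
  [set A | Jbar C A /\ Jbar_eval chi A].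

Program Definition J_germBase := @GermBase C J_germ_sets _ _ _ _ _.
Next Obligation. by move=> chi e chie; exists e. Qed.
Next Obligation.
move=> chi _ _ [e chie <-] [f chif <-]; exists (jmeet e f) => //=.
by rewrite Omega_meet chie.
Qed.
Next Obligation.
move=> chi _ e f [d chid <-] /= def chie.
by apply: (@Omega_sub _ _ (jmeet d e)) => //; rewrite Omega_meet chid.
Qed.
Next Obligation. by move=> s chi H _ [e chie <-]; exists (jpreimage s e). Qed.
Next Obligation.
move=> chi _ [e chie <-]; near=> psi; exists e => //=.
by rewrite (near (Omega_eval_near chi e) psi).
Unshelve. all: by end_near. Qed.

Lemma Jbar_eval_Jbar (chi : Omega C) A : Jbar_eval chi A -> Jbar C A.
Proof. by move=> [e [F [? ? ? _ _]]]; exists e, F. Qed.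

Program Definition Jbar_germBase := @GermBase C Jbar_germ_sets _ _ _ _ _.
Next Obligation.
move=> chi e chie; suff chiA : Jbar_eval chi (\val e).
  by split => //; exact: Jbar_eval_Jbar chiA.
exists e, set0; split => //.
by rewrite bigcup_set0 setD0.
Qed.
Next Obligation.
move=> chi A B [_ chiA] [_ chiB]; have chiAB := Jbar_evalI chiA chiB.
by split => //; exact: Jbar_eval_Jbar chiAB.
Qed.
Next Obligation.
move=> chi A e f [_ chiA] Aef chie.
have [||g -> //] := Jbar_eval_cover (G := [set f]) chiA _ _ chie.
  exact: finite_set1.
by move=> x /Aef fx; exists f.
Qed.
Next Obligation.
move=> s chi H A [_ /Jbar_eval_preimage chiA].
by split => //; exact: Jbar_eval_Jbar chiA.
Qed.
Next Obligation. by move=> chi A [JA] /Jbar_eval_near; apply: filterS. Qed.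

End JGerms.

Section Germs.
Variables (C : lcCategory) (N : germBase C).

Definition germ_pairs : set (discrete_topology (Il C) * Omega C) :=
  [set p : (discrete_topology (Il C) * Omega C)%type | \val p.2 (jdom p.1)].

Implicit Types (p q r : germ_pairs).

Definition pair_il p : Il C := (\val p).1.
Definition pair_source p : Omega C := (\val p).2.

Lemma pairP p : \val (pair_source p) (jdom (pair_il p)).
Proof. exact: (set_valP p). Qed.

Definition mkpair (s : Il C) (chi : Omega C) (H : \val chi (jdom s)) :
  germ_pairs := SigSub (mem_set (H : germ_pairs (s, chi))).

Lemma pair_eq p q :
  pair_il p = pair_il q -> pair_source p = pair_source q -> p = q.
Proof.
rewrite /pair_il /pair_source => e1 e2; apply/val_inj.
by case: (\val p) (\val q) e1 e2 => ? ? [? ?] /= -> ->.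
Qed.

Definition pair_range p : Omega C := act (pairP p).

Definition germ_eq p q : Prop := pair_source p = pair_source q /\
  exists2 A, N (pair_source p) A &
    prestrict (\val (pair_il p)) A = prestrict (\val (pair_il q)) A.

Definition germ_rel : rel germ_pairs := [rel p q | `[< germ_eq p q >]].

Lemma germ_rel_refl : reflexive germ_rel.
Proof.
move=> p; apply/asboolP; split => //.
by exists (\val (jdom (pair_il p))) => //; apply/germ_sets_J/pairP.
Qed.

Lemma germ_rel_sym : symmetric germ_rel.
Proof.
move=> p q; apply/asboolP/asboolP => -[e [A NA pq]].
  by split => //; exists A; rewrite // -e.
by split => //; exists A; rewrite // -e.
Qed.

Lemma prestrict_sub (T : Type) (s t : set (T * T)) (A B : set T) :
  B `<=` A -> prestrict s A = prestrict t A -> prestrict s B = prestrict t B.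
Proof.
move=> BA st; apply/seteqP; split=> x /= [sx Bx]; split=> //.
  suff : prestrict t A x by case.
  by rewrite -st; split=> //; exact: BA.
suff : prestrict s A x by case.
by rewrite st; split=> //; exact: BA.
Qed.

Lemma germ_rel_trans : transitive germ_rel.
Proof.
move=> q p r /asboolP[epq [A NA pq]] /asboolP[eqr [B NB qr]].
apply/asboolP; split; first by rewrite epq.
exists (A `&` B); first by apply: germ_setsI => //; rewrite epq.
transitivity (prestrict (\val (pair_il q)) (A `&` B)).
  by apply: prestrict_sub pq => x [].
by apply: prestrict_sub qr => x [].
Qed.

Canonical germ_equiv_rel :=
  EquivRel germ_rel germ_rel_refl germ_rel_sym germ_rel_trans.

(* [Il C] carries the discrete topology, [germ_pairs] the subspace topology of
   the product, and [germ] the quotient topology; see [open_germ_slice],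
   [germ_slice_injP] and [germ_source_continuous]. *)
Definition germ := quotient_topology {eq_quot germ_equiv_rel}.

Definition germ_class p : germ := \pi_germ p.

Lemma germ_classP p q : germ_class p = germ_class q <-> germ_eq p q.
Proof.
have eP := @eqquotP _ germ_rel {eq_quot germ_equiv_rel} p q.
by split=> [/eP /asboolP //|pq]; apply/eP/asboolP.
Qed.

Lemma germ_class_repr (g : germ) : germ_class (repr g) = g.
Proof. exact: reprK. Qed.

Lemma germ_eq_repr p : germ_eq (repr (germ_class p)) p.
Proof. by apply/germ_classP; rewrite germ_class_repr. Qed.

Lemma open_germ_pairsP (U : set germ_pairs) : open U <->
  forall p, U p -> \forall chi \near pair_source p,
    forall q, pair_il q = pair_il p -> pair_source q = chi -> U q.
Proof.
split.
  move=> [V oV <-] p Up; move: oV; rewrite openE => /(_ _ Up).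
  move=> [[/= A B] [/= nA nB]] ABV.
  apply: filterS nB => chi Bchi q qp qchi; apply: ABV.
  split=> /=; last by rewrite -/(pair_source q) qchi.
  by rewrite -/(pair_il q) qp; exact: nbhs_singleton nA.
move=> H; exists [set sc | \forall chi \near sc.2,
    forall q, pair_il q = sc.1 -> pair_source q = chi -> U q].
  rewrite openE => -[s chi] /= Usc.
  exists ([set s], [set psi | \forall chi \near psi,
    forall q, pair_il q = s -> pair_source q = chi -> U q]).
    split; first exact: discrete_set1.
    exact: nbhs_interior Usc.
  by move=> [t psi] [/= ->].
apply/seteqP; split=> p /=; last exact: H.
by move=> /nbhs_singleton; apply.
Qed.

Lemma open_germP (U : set germ) : open U <->
  forall p, U (germ_class p) -> \forall chi \near pair_source p,
    forall q, pair_il q = pair_il p -> pair_source q = chi ->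
      U (germ_class q).
Proof. exact: (open_germ_pairsP (germ_class @^-1` U)). Qed.

Lemma nbhs_germE p (W : set germ) : nbhs (germ_class p) W <->
  \forall chi \near pair_source p,
    forall q, pair_il q = pair_il p -> pair_source q = chi ->
      W (germ_class q).
Proof.
split.
  rewrite nbhsE => -[V [/open_germP oV Vp] VW].
  have := oV _ Vp; apply: filterS => chi + q qp qchi => /(_ q qp qchi).
  exact: VW.
pose O := [set chi : Omega C | forall q,
  pair_il q = pair_il p -> pair_source q = chi -> W (germ_class q)].
move=> nO; have {}nO : nbhs (pair_source p) O := nO.
rewrite nbhsE; exists [set germ_class q | q in
    [set q | pair_il q = pair_il p /\ interior O (pair_source q)]]; last first.
  by move=> _ [q [qp /nbhs_singleton Oq] <-]; exact: Oq.
split; last by exists p => //; split.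
apply/open_germP => r [q [qp Oq] /germ_classP[qr [A NA qrA]]].
near=> chi.
have NA' : N chi A by near: chi; apply: germ_sets_near; rewrite -qr.
have Ochi : interior O chi by near: chi; rewrite -qr; exact: nbhs_interior Oq.
have H : \val chi (jdom (pair_il q)).
  by rewrite (near (Omega_eval_near (pair_source r) _) chi)// -qr; exact: pairP.
move=> r' r'r r'chi; exists (mkpair H); first by split.
by apply/germ_classP; split=> //; exists A; rewrite // r'r.
Unshelve. all: by end_near. Qed.

Lemma open_germ_slice (s : Il C) (O : set (Omega C)) : open O ->
  open [set germ_class p | p in
    [set p | pair_il p = s /\ O (pair_source p)]].
Proof.
move=> oO; rewrite openE => _ [p [ps Op] <-]; apply/nbhs_germE.
have : nbhs (pair_source p) O by exact: open_nbhs_nbhs.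
apply: filterS => chi Ochi q qp qchi; exists q => //.
by rewrite /= qp ps qchi.
Qed.

Lemma act_continuous p (O : set (Omega C)) : nbhs (pair_range p) O ->
  \forall chi \near pair_source p,
    forall q, pair_il q = pair_il p -> pair_source q = chi -> O (pair_range q).
Proof.
move=> [_ [[V oV <-]] Vp VO].
have cact : (act_fun (pair_il p) \o (fun chi : Omega C => \val chi)) @
    pair_source p --> act_fun (pair_il p) (\val (pair_source p)).
  have FF := fmap_filter
    (act_fun (pair_il p) \o (fun chi : Omega C => \val chi))
    (nbhs_filter (pair_source p)).
  apply/cvg_sup => e U [_ [[W oW <-]] We WU].
  have := Omega_eval_near (pair_source p) (jpreimage (pair_il p) e).
  apply: filterS => chi chie; apply: WU => /=.
  by move: We; rewrite /act_fun/= chie.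
have : nbhs (act_fun (pair_il p) (\val (pair_source p))) V.
  exact: open_nbhs_nbhs (conj oV Vp).
move=> /cact nV; have : nbhs (pair_source p)
    [set chi : Omega C | V (act_fun (pair_il p) (\val chi))] := nV.
apply: filterS => chi Vchi q qp qchi; apply: VO => /=.
by move: Vchi; rewrite /= -qp -qchi.
Qed.

Lemma germ_slice_injP p q : pair_il p = pair_il q ->
  germ_class p = germ_class q <-> pair_source p = pair_source q.
Proof.
move=> pq; split=> [/germ_classP[]//|pqs]; congr germ_class.
exact: pair_eq.
Qed.

Definition germ_source (g : germ) : Omega C := pair_source (repr g).
Definition germ_range (g : germ) : Omega C := pair_range (repr g).

Lemma germ_sourceE p : germ_source (germ_class p) = pair_source p.
Proof. by have [] := germ_eq_repr p. Qed.

Lemma germ_eq_range p q : germ_eq p q -> pair_range p = pair_range q.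
Proof.
move=> [pq [A NA pqA]]; apply/val_inj/funext => e /=; rewrite /act_fun -pq.
apply/idP/idP => chie; apply: germ_sets_sub NA _ chie => x [Ax [y xy ey]].
  suff : prestrict (\val (pair_il q)) A (x, y) by case=> ? _; exists y.
  by rewrite -pqA.
suff : prestrict (\val (pair_il p)) A (x, y) by case=> ? _; exists y.
by rewrite pqA.
Qed.

Lemma germ_rangeE p : germ_range (germ_class p) = pair_range p.
Proof. exact/germ_eq_range/germ_eq_repr. Qed.

Lemma pair_mul_subproof p q : pair_source p = pair_range q ->
  \val (pair_source q) (jdom (il_comp (pair_il p) (pair_il q))).
Proof.
move=> pq; have := pairP p; rewrite pq /= /act_fun.
congr (\val (pair_source q) _); apply/val_inj/seteqP; split=> x /=.
  by move=> [y xy [z yz]]; exists z, y.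
by move=> [z [y /= xy yz]]; exists y => //; exists z.
Qed.

(* [s, t.chi][t, chi] = [st, chi] *)
Definition pair_mul p q (H : pair_source p = pair_range q) : germ_pairs :=
  mkpair (pair_mul_subproof H).

(* The value [g] is irrelevant. *)
Definition germ_mul (g h : germ) : germ :=
  if pselect (germ_source g = germ_range h) is left H
  then germ_class (pair_mul H) else g.

Lemma germ_mulE p q (H : pair_source p = pair_range q) :
  germ_mul (germ_class p) (germ_class q) = germ_class (pair_mul H).
Proof.
rewrite /germ_mul; case: pselect => [H'|]; last first.
  by rewrite germ_sourceE germ_rangeE.
apply/germ_classP; move: H'; rewrite /germ_source /germ_range => H'.
have [pp [B NB ppB]] := germ_eq_repr p; have [qq [A NA qqA]] := germ_eq_repr q.
set p' := repr (germ_class p) in H' pp NB ppB *.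
set q' := repr (germ_class q) in H' qq NA qqA *.
split => //=; exists (A `&` ppreimage (\val (pair_il q')) B).
  apply: germ_setsI => //; apply: (germ_sets_preimage (H := pairP q')).
  by rewrite H' in NB.
have qfun r := (Il_partial_bijection (pair_il r)).1.
apply/seteqP; split=> -[x y] /=.
  move=> [[z /= xz zy] [Ax [w xw Bw]]]; split => //=; last first.
    by split=> //; exists w.
  have zw := qfun q' _ _ _ xz xw; rewrite -zw in Bw.
  exists z => /=.
    suff : prestrict (\val (pair_il q)) A (x, z) by case.
    by rewrite -qqA.
  suff : prestrict (\val (pair_il p)) B (z, y) by case.
  by rewrite -ppB.
move=> [[z /= xz zy] [Ax [w xw Bw]]]; split => //=; last first.
  by split=> //; exists w.
have xz' : \val (pair_il q') (x, z).
  suff : prestrict (\val (pair_il q')) A (x, z) by case.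
  by rewrite qqA.
have zw := qfun q' _ _ _ xz' xw; rewrite -zw in Bw.
exists z => //=.
suff : prestrict (\val (pair_il p')) B (z, y) by case.
by rewrite ppB.
Qed.

Lemma pair_mul_range p q (H : pair_source p = pair_range q) :
  pair_range (pair_mul H) = pair_range p.
Proof.
apply/val_inj/funext => e /=; rewrite /act_fun H /= /act_fun.
congr (\val (pair_source q) _); apply/val_inj/seteqP; split=> x /=.
  by move=> [z [y /= xy yz] ez]; exists y => //; exists z.
by move=> [y xy [z yz ez]]; exists z => //; exists y.
Qed.

Lemma pair_inv_subproof p : \val (pair_range p) (jdom (il_inv (pair_il p))).
Proof.
have := pairP p; rewrite /= /act_fun.
congr (\val (pair_source p) _); apply/val_inj/seteqP; split=> x /=.
  by move=> [y xy]; exists y => //; exists x.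
by move=> [y xy _]; exists y.
Qed.

Definition pair_inv p : germ_pairs := mkpair (pair_inv_subproof p).

Lemma pair_inv_range p : pair_range (pair_inv p) = pair_source p.
Proof.
have [sf si] := Il_partial_bijection (pair_il p).
apply/val_inj/funext => e /=; rewrite /act_fun /= /act_fun.
transitivity (\val (pair_source p) (jmeet e (jdom (pair_il p)))).
  congr (\val (pair_source p) _); apply/val_inj/seteqP; split=> x /=.
    move=> [y xy [z /= zy ez]]; rewrite (si _ _ _ xy zy); split => //.
    by exists y; rewrite -?(si _ _ _ xy zy).
  by move=> [ex [y xy]]; exists y => //; exists x.
by rewrite Omega_meet pairP andbT.
Qed.

(* [s, chi]^-1 = [s^-1, s.chi] *)
Definition germ_inv (g : germ) : germ := germ_class (pair_inv (repr g)).

Lemma germ_invE p : germ_inv (germ_class p) = germ_class (pair_inv p).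
Proof.
apply/germ_classP; have pp := germ_eq_repr p.
have ppr := germ_eq_range pp; case: pp => pp [A NA ppA].
set p' := repr (germ_class p) in pp ppr NA ppA *.
split => //=; exists (ppreimage (\val (il_inv (pair_il p'))) A).
  apply: (germ_sets_preimage (H := pair_inv_subproof p')).
  rewrite (_ : act _ = pair_source p')// -[RHS]pair_inv_range.
  exact/val_inj.
have si r := (Il_partial_bijection (pair_il r)).2.
apply/seteqP; split=> -[x y] /= [yx [z /= zx Az]]; split => //=.
- have yz := si p' _ _ _ yx zx; rewrite -yz in Az.
  suff : prestrict (\val (pair_il p)) A (y, x) by case.
  by rewrite -ppA.
- by exists z.
- have zx' : prestrict (\val (pair_il p)) A (z, x) by rewrite -ppA.
  by rewrite (_ : y = z)//; exact: si p _ _ _ yx zx'.1.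
- by exists z.
Qed.

Lemma pair_unit_subproof (chi : Omega C) (e : Jl C) :
  \val chi e -> \val chi (jdom (il_id e)).
Proof.
congr (\val chi _); apply/val_inj/seteqP; split=> x /=.
  by move=> ex; exists x.
by case=> y /= [].
Qed.

Definition pair_unit (chi : Omega C) (e : Jl C) (H : \val chi e) : germ_pairs :=
  mkpair (pair_unit_subproof H).

(* the unit [e, chi], for any e in J with chi(e) = 1 *)
Definition germ_unit (chi : Omega C) : germ :=
  germ_class (pair_unit (projT2 (cid (Omega_nonzero chi)))).

Lemma germ_eq_unit p (chi : Omega C) (A : set C) : N chi A ->
  pair_source p = chi ->
  (forall x, A x -> \val (pair_il p) (x, x)) -> germ_class p = germ_unit chi.
Proof.
move=> NA pchi pA; rewrite /germ_unit.
case: (cid _) => /= e chie; apply/germ_classP; split=> //=.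
have [sf _] := Il_partial_bijection (pair_il p).
exists (A `&` \val e).
  by rewrite pchi; apply: germ_setsI => //; exact: germ_sets_J.
apply/seteqP; split=> -[x y] /=.
  move=> [xy [Ax ex]]; split => //; split => //=.
  exact: sf (pA _ Ax) xy.
by move=> [[/= <- _] [Ax ex]]; split => //; exact: pA.
Qed.

Lemma germ_unitE (chi : Omega C) (e : Jl C) (H : \val chi e) :
  germ_class (pair_unit H) = germ_unit chi.
Proof. by apply: (germ_eq_unit (germ_sets_J _ H)). Qed.

Lemma pair_unit_range (chi : Omega C) (e : Jl C) (H : \val chi e) :
  pair_range (pair_unit H) = chi.
Proof.
apply/val_inj/funext => f /=; rewrite /act_fun.
transitivity (\val chi (jmeet e f)); last by rewrite Omega_meet H.
congr (\val chi _); apply/val_inj/seteqP; split=> x /=.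
  by move=> [y /= [<- ex] fx].
by move=> [ex fx]; exists x.
Qed.

Lemma germ_source_unit chi : germ_source (germ_unit chi) = chi.
Proof. exact: germ_sourceE. Qed.

Lemma germ_range_unit chi : germ_range (germ_unit chi) = chi.
Proof. by rewrite germ_rangeE pair_unit_range. Qed.

Lemma germ_source_mul g h : germ_source g = germ_range h ->
  germ_source (germ_mul g h) = germ_source h.
Proof.
move=> gh; rewrite -[in LHS](germ_class_repr g) -[in LHS](germ_class_repr h).
by rewrite germ_mulE germ_sourceE.
Qed.

Lemma germ_range_mul g h : germ_source g = germ_range h ->
  germ_range (germ_mul g h) = germ_range g.
Proof.
move=> gh; rewrite -[in LHS](germ_class_repr g) -[in LHS](germ_class_repr h).
by rewrite germ_mulE germ_rangeE pair_mul_range.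
Qed.

Lemma germ_is_category :
  is_category germ_source germ_range germ_unit germ_mul.
Proof.
split.
- exact: germ_source_unit.
- exact: germ_range_unit.
- exact: germ_source_mul.
- exact: germ_range_mul.
- move=> g; rewrite -(germ_class_repr g) germ_rangeE; set p := repr g.
  have [e ep] := Omega_nonzero (pair_range p).
  rewrite -(germ_unitE ep) germ_mulE; apply/germ_classP; split=> //=.
  exists (ppreimage (\val (pair_il p)) (\val e)).
    by apply: (germ_sets_preimage (H := pairP p)); exact: germ_sets_J.
  have [sf _] := Il_partial_bijection (pair_il p).
  apply/seteqP; split=> -[x y] /= [xy [z xz ez]]; split=> //=; first last.
  + by exists z.
  + by exists y => //; rewrite (sf _ _ _ xy xz).
  + by exists z.
  + by case: xy => w /= xw [<-].
- move=> g; rewrite -(germ_class_repr g) germ_sourceE; set p := repr g.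
  have [e ep] := Omega_nonzero (pair_source p).
  have H : pair_source p = pair_range (pair_unit ep) by rewrite pair_unit_range.
  rewrite -(germ_unitE ep) (germ_mulE H); apply/germ_classP; split=> //=.
  exists (\val e); first exact: germ_sets_J.
  apply/seteqP; split=> -[x y] /= [xy ex]; split=> //=.
    by case: xy => w /= [<-].
  by exists x.
- move=> a b c ab bc.
  rewrite -(germ_class_repr a) -(germ_class_repr b) -(germ_class_repr c).
  have Hab : pair_source (repr a) = pair_range (repr b) by [].
  have Hbc : pair_source (repr b) = pair_range (repr c) by [].
  have Hab_c : pair_source (pair_mul Hab) = pair_range (repr c) by [].
  have Ha_bc : pair_source (repr a) = pair_range (pair_mul Hbc).
    by rewrite pair_mul_range.
  rewrite (germ_mulE Hab) (germ_mulE Hbc) (germ_mulE Hab_c) (germ_mulE Ha_bc).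
  congr germ_class; apply: pair_eq => //.
  apply/val_inj/seteqP; split=> -[x y] /=.
    by move=> [v /= [u /= xu uv] vy]; exists u => //; exists v.
  by move=> [u /= xu [v /= uv vy]]; exists v => //; exists u.
Qed.

Lemma germ_source_inv g : germ_source (germ_inv g) = germ_range g.
Proof. by rewrite germ_sourceE. Qed.

Lemma germ_range_inv g : germ_range (germ_inv g) = germ_source g.
Proof. by rewrite germ_rangeE pair_inv_range. Qed.

Lemma germ_mulVg g : germ_mul (germ_inv g) g = germ_unit (germ_source g).
Proof.
rewrite -{2}(germ_class_repr g) germ_mulE; set p := repr g.
apply: (germ_eq_unit (germ_sets_J _ (pairP p))) => // x [y xy].
by exists y.
Qed.

Lemma germ_mulgV g : germ_mul g (germ_inv g) = germ_unit (germ_range g).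
Proof.
have H : pair_source (repr g) = pair_range (pair_inv (repr g)).
  by rewrite pair_inv_range.
rewrite -{1}(germ_class_repr g) (germ_mulE H).
apply: (germ_eq_unit (germ_sets_J _ (pair_inv_subproof (repr g)))) => // x [y].
by exists y.
Qed.

Lemma germ_source_continuous : continuous germ_source.
Proof.
move=> g W; rewrite -(germ_class_repr g) germ_sourceE => nW.
apply/nbhs_germE; apply: filterS nW => chi Wchi q _ qchi /=.
by rewrite germ_sourceE qchi.
Qed.

Lemma germ_range_continuous : continuous germ_range.
Proof.
move=> g W; rewrite -(germ_class_repr g) germ_rangeE => /act_continuous nW.
apply/nbhs_germE; apply: filterS nW => chi Wchi q qp qchi /=.
by rewrite germ_rangeE; exact: Wchi.
Qed.

Lemma germ_unit_continuous : continuous germ_unit.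
Proof.
move=> chi W; have [e chie] := Omega_nonzero chi.
rewrite -(germ_unitE chie) => /nbhs_germE nW.
have ne := Omega_eval_near chi e.
apply: filterS2 nW ne => psi nW psiE; have psie : \val psi e by rewrite psiE.
by rewrite /= -(germ_unitE psie); exact: nW.
Qed.

Lemma germ_mul_continuous :
  {within [set p | germ_source p.1 = germ_range p.2],
    continuous (fun p : germ * germ => germ_mul p.1 p.2)}.
Proof.
apply/subspace_continuousP => -[g h] /= gh W.
have ghE : germ_mul g h = germ_class (@pair_mul (repr g) (repr h) gh).
  rewrite -[in LHS](germ_class_repr g) -[in LHS](germ_class_repr h).
  exact: germ_mulE.
move=> nW; have {nW} : nbhs (germ_mul g h) W := nW.
rewrite ghE => /nbhs_germE nW.
pose O := [set psi : Omega C | forall q,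
  pair_il q = il_comp (pair_il (repr g)) (pair_il (repr h)) ->
  pair_source q = psi -> W (germ_class q)].
exists ([set germ_class p | p in [set p | pair_il p = pair_il (repr g)]],
  [set germ_class q | q in [set q | pair_il q = pair_il (repr h) /\
                                    O (pair_source q)]]) => /=.
  split.
    rewrite -{1}(germ_class_repr g); apply/nbhs_germE.
    apply: (@filterS _ _ (nbhs_filter (pair_source (repr g))) setT) => //.
      by move=> psi _ q qg _; exists q.
    exact: filterT.
  rewrite -{1}(germ_class_repr h); apply/nbhs_germE.
  have nO : nbhs (pair_source (repr h)) O := nW.
  apply: filterS nO => psi Opsi q qh qpsi.
  by exists q => //; split=> //=; rewrite qpsi.
move=> [_ _] [/= [p pg <-] [q [qh Oq] <-]] /=.
rewrite germ_sourceE germ_rangeE => pq.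
suff : W (germ_mul (germ_class p) (germ_class q)) by [].
rewrite (germ_mulE pq).
by apply: (Oq (pair_mul pq)) => //=; rewrite /pair_il/= -!/(pair_il _) pg qh.
Qed.

Lemma germ_inv_continuous : continuous germ_inv.
Proof.
move=> g W; rewrite {1}/germ_inv => /nbhs_germE /act_continuous nW.
rewrite -(germ_class_repr g); apply/nbhs_germE.
apply: filterS nW => chi nchi q qg qchi /=; rewrite germ_invE.
by apply: (nchi q qg qchi) => //; rewrite /pair_il /= -!/(pair_il _) qg.
Qed.

Definition germ_groupoid : topGroupoid :=
  TopGroupoid germ_is_category germ_source_inv germ_range_inv
    germ_mulVg germ_mulgV germ_source_continuous germ_range_continuous
    germ_unit_continuous germ_mul_continuous germ_inv_continuous.

End Germs.
Arguments germ_pairs C : clear implicits.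

(* I_l |x Omega *)
Definition groupoid_J (C : lcCategory) := germ_groupoid (J_germBase C).

(* I_l \bar|x Omega *)
Definition groupoid_Jbar (C : lcCategory) := germ_groupoid (Jbar_germBase C).

Definition canonical_projection (C : lcCategory) :
  groupoid_J C -> groupoid_Jbar C :=
  fun g => germ_class (Jbar_germBase C) (repr g).

Lemma canonical_projectionE (C : lcCategory) (p : germ_pairs C) :
  canonical_projection (germ_class (J_germBase C) p) =
  germ_class (Jbar_germBase C) p.
Proof.
apply/germ_classP; have [pp [A NA ppA]] := germ_eq_repr (J_germBase C) p.
split=> //; exists A => //; case: NA => e chie <-.
exact: (germ_sets_J (Jbar_germBase C)).
Qed.

(* Main.v *)
Require Import Defs.
From mathcomp Require Import all_boot all_classical topology.

(** Both groupoids are spaces of germs of partial bijections, so the canonical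
projection is a continuous open groupoid morphism over the identity of
[Omega C], and it is an isomorphism as soon as it is injective: if [s] and [t]
agree on some [A] of the form [e \ (f_1 u ... u f_n)] with [chi(A) = 1], then
they must agree on some [e'] in the semilattice with [chi(e') = 1]
([Jbar_germ_eq_J]).

The elements of I_l commute with right multiplication ([Il_comp_right]), so two
of them that agree at a point [x] agree on the whole principal right ideal
[xC], which belongs to the semilattice. It remains to find suitable points.

If [C] is finitely aligned, every element of the semilattice is a finite union
of principal right ideals ([Jl_fg_ideal]). Since [chi] is in [Omega C], some
ideal [xC] in such a decomposition of the intersection of [e] and the domains of
[s] and [t] has [chi(xC) = 1]. Then no [f_i] contains [x], for it would
contain [xC] and thus satisfy [chi(f_i) = 1]. Hence [x] is in [A], and [s] and
[t] agree on [xC].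

If the groupoid of J-germs is Hausdorff, consider the characters
[point_char x : e |-> (x \in e)]. They converge to [chi] along the filter
generated by the sets [A] with [chi(A) = 1] ([point_char_near]). For [x] in
such an [A] on which [s] and [t] agree, the germs of [s] and [t] at
[point_char x] coincide, because of the ideal [xC]. So the germs of [s] and [t]
at [chi] cannot be separated, hence are equal. *)

Set Implicit Arguments.
Unset Strict Implicit.
Unset Printing Implicit Defensive.

Local Open Scope classical_set_scope.
Local Open Scope relation_scope.

(* Composition of morphisms, not of functions. *)
Local Notation comp := Defs.comp.

(** * Right ideals *)

Section RightIdeals.
Variable C : smallCategory.
Implicit Types (a b c x y : C) (s : set (C * C)) (A : set C).

Lemma right_ideal_id c : right_ideal c c.
Proof.
have H := smallCategoryP C.
exists (idm (dom c)); last exact: (comp_idr H).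
by rewrite /= (cod_idm H).
Qed.

(** Partial bijections in I_l are morphisms of right C-sets. *)
Lemma Il_comp_right s x y : left_inverse_hull s -> s (x, y) ->
  dom x = dom y /\ forall c, dom x = cod c -> s (comp x c, comp y c).
Proof.
have H := smallCategoryP C.
move=> Is; elim: Is x y => {s}.
- move=> a x y [/= ax ->]; rewrite (dom_comp H)//; split=> // c xc.
  by split; rewrite /= ?(cod_comp H)// (Defs.compA H).
- by move=> s _ IH x y /IH[xy sxy]; split=> // c; rewrite -xy; exact: sxy.
- move=> s t _ IHs _ IHt x y [z /= /IHt[xz txz] /IHs[zy szy]].
  split=> [|c xc]; first by rewrite xz.
  by exists (comp z c); [exact: txz|apply: szy; rewrite -xz].
Qed.

Lemma Il_agree_right_ideal s t x y : left_inverse_hull s ->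
  left_inverse_hull t -> (forall u v w, s (u, v) -> s (u, w) -> v = w) ->
  s (x, y) -> t (x, y) -> prestrict s (right_ideal x) `<=`
    prestrict t (right_ideal x).
Proof.
move=> Is It sf /(Il_comp_right Is)[_ sxy] /(Il_comp_right It)[_ txy].
move=> [u z] [/= + [c /= xc cE]]; rewrite -cE => sz.
split; last by exists c.
by rewrite (sf _ _ _ sz (sxy _ xc)); exact: txy.
Qed.

End RightIdeals.

Section Points.
Variable C : lcCategory.
Implicit Types (s t : Il C) (e f : Jl C) (x y : C) (chi : Omega C).

Lemma Jl_right_ideal x : Jl C (right_ideal x).
Proof.
exists (lmul x)^-1; first by do !constructor.
apply/seteqP; split=> y /=.
  by move=> [z [/= xz ->]]; exists z.
by move=> [z /= xz <-]; exists z.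
Qed.

(** The principal right ideal [xC] as an element of the semilattice. *)
Definition jideal x : Jl C := SigSub (mem_set (Jl_right_ideal x)).

Lemma jideal_sub x e : \val e x -> \val (jideal x) `<=` \val e.
Proof.
case: (set_valP e) => s Is <- [y /(Il_comp_right Is)[_ sxy]] _ [c /= xc <-].
by exists (comp y c); exact: sxy.
Qed.

(** Two elements of I_l that are both defined at a common point and agree there
have equal restrictions to the right ideal generated by that point. *)
Lemma prestrict_jideal s t x y : \val s (x, y) -> \val t (x, y) ->
  prestrict (\val s) (\val (jideal x)) = prestrict (\val t) (\val (jideal x)).
Proof.
move=> sxy txy; have [sf _] := Il_partial_bijection s.
have [tf _] := Il_partial_bijection t.
have Is := set_valP s; have It := set_valP t.
by apply/seteqP; split; [exact: Il_agree_right_ideal sxy txy|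
  exact: Il_agree_right_ideal txy sxy].
Qed.

Lemma prestrict_eq_at s t (A : set C) x :
  prestrict (\val s) A = prestrict (\val t) A -> A x -> \val (jdom s) x ->
  exists2 y, \val s (x, y) & \val t (x, y).
Proof.
move=> stA Ax [y sxy]; exists y => //.
suff : prestrict (\val t) A (x, y) by case.
by rewrite -stA.
Qed.

(** * The finitely aligned case *)

(** Finitely generated right ideals: finite unions of principal ones. *)
Definition fg_ideal (A : set C) :=
  exists2 F : set C, finite_set F & A = \bigcup_(c in F) right_ideal c.

Lemma fg_ideal_bigcup (F : set C) (G : C -> set C) : finite_set F ->
  (forall c, F c -> fg_ideal (G c)) -> fg_ideal (\bigcup_(c in F) G c).
Proof.
move=> finF FG.
have /choice [H HP] : forall c, exists H : set C,
    finite_set H /\ (F c -> G c = \bigcup_(d in H) right_ideal d).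
  move=> c; have [/FG[H finH GH]|nFc] := pselect (F c); first by exists H.
  by exists set0; split=> //; exact: finite_set0.
exists (\bigcup_(c in F) H c).
  by apply: bigcup_finite => // c _; have [] := HP c.
rewrite bigcup_bigcup; apply: eq_bigcupr => c Fc.
by have [_ ->] := HP c.
Qed.

Lemma fg_ideal0 : fg_ideal set0.
Proof. by exists set0; [exact: finite_set0|rewrite bigcup_set0]. Qed.

Lemma fg_right_ideal x : fg_ideal (right_ideal x).
Proof. by exists [set x]; [exact: finite_set1|rewrite bigcup_set1]. Qed.

(** It suffices to test on principal ideals that preimages under a relation
preserve finite generation. *)
Lemma fg_ideal_preimage (s : set (C * C)) :
  (forall a, fg_ideal (ppreimage s (right_ideal a))) ->
  forall A, fg_ideal A -> fg_ideal (ppreimage s A).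
Proof.
move=> sP _ [F finF ->].
rewrite (_ : ppreimage _ _ = \bigcup_(a in F) ppreimage s (right_ideal a)).
  exact: fg_ideal_bigcup.
apply/seteqP; split=> x /=.
  by move=> [y sxy [a Fa ay]]; exists a => //; exists y.
by move=> [a Fa [y sxy ay]]; exists y => //; exists a.
Qed.

(** [{x | c x \in a C}] is generated by the cofactors [f'] of the generators
[f = c f'] of the intersection of [c C] and [a C]. *)
Lemma fg_ideal_lmul_preimage c a : finitely_aligned C ->
  fg_ideal (ppreimage (lmul c) (right_ideal a)).
Proof.
have H := smallCategoryP C.
move=> /(_ c a)[F finF caF].
have /choice [g gP] : forall f : C, exists f' : C,
    F f -> dom c = cod f' /\ comp c f' = f.
  move=> f; have [Ff|nFf] := pselect (F f); last by exists f.
  have : (\bigcup_(c in F) right_ideal c) f.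
    by exists f => //; exact: right_ideal_id.
  by rewrite -caF => -[[f' /= cf' <-] _]; exists f'.
exists (g @` F); first exact: finite_image.
apply/seteqP; split=> x /=.
  move=> [_ [/= cx ->] acx].
  have : (right_ideal c `&` right_ideal a) (comp c x) by split=> //; exists x.
  rewrite caF => -[f Ff [y /= fy fyE]]; exists (g f); first by exists f.
  have [cg cgE] := gP f Ff.
  have gy : dom (g f) = cod y by rewrite -fy -[in RHS]cgE (dom_comp H).
  exists y => //=; apply: (lcCategoryP (c := c)) => //.
    by rewrite (cod_comp H).
  by rewrite (Defs.compA H)// cgE.
move=> [_ [f Ff <-] [y /= gy <-]]; have [cg cgE] := gP f Ff.
exists (comp c (comp (g f) y)).
  by split=> //=; rewrite (cod_comp H).
rewrite (Defs.compA H)// cgE.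
have : (\bigcup_(c in F) right_ideal c) (comp f y).
  by exists f => //; exists y => //=; rewrite -[in LHS]cgE (dom_comp H).
by rewrite -caF => -[].
Qed.

Lemma fg_ideal_lmul_image c a :
  fg_ideal (ppreimage (lmul c)^-1 (right_ideal a)).
Proof.
have H := smallCategoryP C.
have [ca|nca] := pselect (dom c = cod a).
  rewrite (_ : ppreimage _ _ = right_ideal (comp c a)).
    exact: fg_right_ideal.
  apply/seteqP; split=> x /=.
    move=> [_ [/= _ ->] [z /= az <-]].
    by exists z; rewrite /= ?(dom_comp H)// (Defs.compA H).
  move=> [y /= + <-]; rewrite (dom_comp H)// => ay.
  exists (comp a y); last by exists y.
  by split; rewrite /= ?(cod_comp H)// (Defs.compA H).
rewrite (_ : ppreimage _ _ = set0); first exact: fg_ideal0.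
apply/seteqP; split=> x //= [y [/= cy _] [z /= az yE]].
by apply: nca; rewrite cy -yE (cod_comp H).
Qed.

(** The statement is symmetric in [s] and [s^-1] so that it passes through the
inversion step of the induction. *)
Lemma Il_fg_ideal (s : set (C * C)) : finitely_aligned C ->
  left_inverse_hull s ->
  [/\ fg_ideal (pdom s), fg_ideal (pdom s^-1) &
      forall A, fg_ideal A ->
        fg_ideal (ppreimage s A) /\ fg_ideal (ppreimage s^-1 A)].
Proof.
have H := smallCategoryP C.
move=> fa; elim=> {s}.
- move=> c; split.
  + rewrite (_ : pdom _ = right_ideal (idm (dom c))).
      exact: fg_right_ideal.
    apply/seteqP; split=> x /=.
      move=> [_ [/= cx _]]; exists x; first by rewrite /= (dom_idm H).
      by rewrite cx (comp_idl H).
    move=> [y /=]; rewrite (dom_idm H) => cy <-; rewrite cy (comp_idl H).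
    by exists (comp c y).
  + rewrite (_ : pdom _ = right_ideal c); first exact: fg_right_ideal.
    apply/seteqP; split=> x /=.
      by move=> [y [/= cy ->]]; exists y.
    by move=> [y /= cy <-]; exists y.
  + move=> A fgA; split; apply: fg_ideal_preimage fgA => a.
      exact: fg_ideal_lmul_preimage.
    exact: fg_ideal_lmul_image.
- by move=> s _ [fd fr fp]; split=> // A /fp[].
- move=> s t _ [sd sr sp] _ [td tr tp]; split.
  + rewrite (_ : pdom _ = ppreimage t (pdom s)); first by have [] := tp _ sd.
    apply/seteqP; split=> x /=.
      by move=> [y [z /= xz zy]]; exists z => //; exists y.
    by move=> [z xz [y zy]]; exists y, z.
  + rewrite (_ : pdom _ = ppreimage s^-1 (pdom t^-1)).
      by have [] := sp _ tr.
    apply/seteqP; split=> x /=.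
      by move=> [y [z /= yz zx]]; exists z => //; exists y.
    by move=> [z zx [y yz]]; exists y, z.
  + move=> A fgA; split.
      rewrite (_ : ppreimage _ _ = ppreimage t (ppreimage s A)).
        by have [+ _] := sp _ fgA; move=> /tp[].
      apply/seteqP; split=> x /=.
        by move=> [y [z /= xz zy] Ay]; exists z => //; exists y.
      by move=> [z xz [y zy Ay]]; exists y => //; exists z.
    rewrite (_ : ppreimage _ _ = ppreimage s^-1 (ppreimage t^-1 A)).
      by have [_] := tp _ fgA; move=> /sp[].
    apply/seteqP; split=> x /=.
      by move=> [y [z /= yz zx] Ay]; exists z => //; exists y.
    by move=> [z zx [y yz Ay]]; exists y => //; exists z.
Qed.

Lemma Jl_fg_ideal e : finitely_aligned C -> fg_ideal (\val e).
Proof.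
by move=> fa; case: (set_valP e) => s Is <-; have [] := Il_fg_ideal fa Is.
Qed.

Lemma Jbar_germ_eq_J_finitely_aligned (p q : germ_pairs C) :
  finitely_aligned C -> germ_eq (Jbar_germBase C) p q ->
  germ_eq (J_germBase C) p q.
Proof.
move=> fa [pq [_ [_ [e [F [finF Fe -> chie chiF]]]] stA]]; split=> //.
set chi := pair_source p in pq chie chiF *.
pose d := jmeet e (jmeet (jdom (pair_il p)) (jdom (pair_il q))).
have chid : \val chi d.
  by rewrite !Omega_meet chie pairP pq pairP.
have [G finG dG] := Jl_fg_ideal d fa.
have /set_mem [_ chiU] := valP chi.
have [||_ [x Gx <-] chix] := chiU d (jideal @` G) _ _ chid.
- exact: finite_image.
- by rewrite dG bigcup_image.
have [ex [px qx]] : \val d x.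
  by rewrite dG; exists x => //; exact: right_ideal_id.
have Ax : (\val e `\` \bigcup_(f in F) \val f) x.
  split=> // -[f Ff fx].
  by have := Omega_sub (jideal_sub fx) chix; rewrite chiF.
have [y pxy qxy] := prestrict_eq_at stA Ax px.
exists (\val (jideal x)); first by exists (jideal x).
exact: prestrict_jideal pxy qxy.
Qed.

(** * The Hausdorff case *)

(** The character of the semilattice given by evaluation at a point. *)
Definition point_fun x : {ptws Jl C -> bool} := fun e => `[< \val e x >].

Lemma point_fun_Omega x : Omega C (point_fun x).
Proof.
split; first split.
- by exists (jideal x); apply/asboolP; exact: right_ideal_id.
- move=> e f; apply/asboolP/andP => /=.
    by move=> [ex fx]; split; apply/asboolP.
  by move=> [/asboolP ex /asboolP fx].
- by move=> e e0; apply/asboolP; rewrite e0.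
- move=> e F _ eF /asboolP; rewrite eF => -[f Ff fx].
  by exists f => //; apply/asboolP.
Qed.

Definition point_char x : Omega C := SigSub (mem_set (point_fun_Omega x)).

Lemma point_charP x e : \val (point_char x) e <-> \val e x.
Proof. by split=> /asboolP. Qed.

Lemma Jbar_eval_J chi e : \val chi e -> Jbar_eval chi (\val e).
Proof. by move=> /(germ_sets_J (Jbar_germBase C))[]. Qed.

Lemma Jbar_eval_nonempty chi (A : set C) : Jbar_eval chi A -> A !=set0.
Proof.
move=> chiA; apply/set0P/eqP => A0; have [d chid] := Omega_nonzero chi.
have [||g //] := Jbar_eval_cover (G := set0) chiA _ _ chid.
  exact: finite_set0.
by rewrite A0 set0I; exact: sub0set.
Qed.

(** Evaluation of characters at any element of the semilattice is constant on
point characters near [chi]. *)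
Lemma Jbar_eval_point chi e : exists2 A, Jbar_eval chi A &
  forall x, A x -> \val (point_char x) e = \val chi e.
Proof.
have [chie|chie] := boolP (\val chi e).
  by exists (\val e); [exact: Jbar_eval_J|move=> x ex; apply/point_charP].
have [d chid] := Omega_nonzero chi.
exists (\val d `\` \bigcup_(f in [set jmeet d e]) \val f).
  exists d, [set jmeet d e]; split=> //.
  - by move=> _ -> x [].
  - by move=> _ ->; rewrite Omega_meet (negbTE chie) andbF.
move=> x [dx nx]; apply/negbTE/negP => /point_charP ex; apply: nx.
by exists (jmeet d e).
Qed.

(** Point characters are dense in [Omega C]; more precisely, [point_char x]
tends to [chi] as [x] runs through the sets [A] with [chi(A) = 1]. *)
Lemma point_char_near chi (U : set (Omega C)) : nbhs chi U ->
  exists2 A, Jbar_eval chi A & forall x, A x -> U (point_char x).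
Proof.
pose FF : set_system C := filter_from (Jbar_eval chi) id.
have FFF : Filter FF.
  apply: filter_from_filter.
    by have [e chie] := Omega_nonzero chi; exists (\val e); exact: Jbar_eval_J.
  by move=> A B chiA chiB; exists (A `&` B) => //; exact: Jbar_evalI.
have cpt : point_fun @ FF --> (\val chi : {ptws Jl C -> bool}).
  have FFm := fmap_filter point_fun FFF.
  apply/cvg_sup => e V [_ [[W oW <-]] We WV].
  have [A chiA Ae] := Jbar_eval_point chi e.
  exists A => // x /Ae; rewrite /= => xe; apply: WV => /=.
  by move: We; rewrite /= -xe.
move=> [_ [[V oV <-]] Vchi VU].
have /cpt [A chiA AV] : nbhs (\val chi : {ptws Jl C -> bool}) V.
  exact: open_nbhs_nbhs (conj oV Vchi).
by exists A => // x Ax; apply: VU; exact: AV.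
Qed.

Lemma Jbar_germ_eq_J_hausdorff (p q : germ_pairs C) :
  hausdorff_space (groupoid_J C) -> germ_eq (Jbar_germBase C) p q ->
  germ_eq (J_germBase C) p q.
Proof.
move=> hs [pq [A [_ chiA] stA]]; apply/germ_classP; apply: hs => U V.
move=> /(nbhs_germE (N := J_germBase C)) nU.
move=> /(nbhs_germE (N := J_germBase C)) nV.
rewrite -pq in nV.
set chi := pair_source p in pq chiA nU nV *.
(* [x] is chosen where [p] and [q] agree and such that the germs of [p] and [q]
at [point_char x] are in [U] and [V]. *)
have [B chiB BU] := point_char_near nU.
have [D chiD DV] := point_char_near nV.
have chip := Jbar_eval_J (pairP p).
have chiq : Jbar_eval chi (\val (jdom (pair_il q))).
  by apply: Jbar_eval_J; rewrite pq; exact: pairP.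
have [x [[Ax [px qx]] [Bx Dx]]] := Jbar_eval_nonempty
  (Jbar_evalI (Jbar_evalI chiA (Jbar_evalI chip chiq)) (Jbar_evalI chiB chiD)).
have Hp : \val (point_char x) (jdom (pair_il p)) by apply/point_charP.
have Hq : \val (point_char x) (jdom (pair_il q)) by apply/point_charP.
exists (germ_class (J_germBase C) (mkpair Hp)); split.
  exact: (BU x Bx (mkpair Hp)).
suff -> : germ_class (J_germBase C) (mkpair Hp) =
    germ_class (J_germBase C) (mkpair Hq) by exact: (DV x Dx (mkpair Hq)).
have [y pxy qxy] := prestrict_eq_at stA Ax px.
apply/germ_classP; split=> //; exists (\val (jideal x)).
  by exists (jideal x) => //; apply/point_charP; exact: right_ideal_id.
exact: prestrict_jideal pxy qxy.
Qed.

End Points.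

(** * The canonical projection *)

Lemma Jbar_germ_eq_J (C : lcCategory) (p q : germ_pairs C) :
  finitely_aligned C \/ hausdorff_space (groupoid_J C) ->
  germ_eq (Jbar_germBase C) p q -> germ_eq (J_germBase C) p q.
Proof.
by case=> [/Jbar_germ_eq_J_finitely_aligned|/Jbar_germ_eq_J_hausdorff]; apply.
Qed.

(** A map that does not change representatives is continuous between spaces of
germs, whatever the two notions of germ are. *)
Lemma germ_map_continuous (C : lcCategory) (N M : germBase C)
    (phi : germ N -> germ M) :
  (forall p, phi (germ_class N p) = germ_class M p) -> continuous phi.
Proof.
move=> phiE g W; rewrite -(germ_class_repr g) phiE => /nbhs_germE nW.
apply/nbhs_germE; apply: filterS nW => chi + q qp qchi => /(_ q qp qchi).
by rewrite /= phiE.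
Qed.

Theorem lemma3p2 (C : lcCategory)
    (hC : finitely_aligned C \/ hausdorff_space (groupoid_J C)) :
  topGroupoid_isomorphism (G := groupoid_J C) (H := groupoid_Jbar C)
    id (@canonical_projection C).
Proof.
pose psi (g : groupoid_Jbar C) : groupoid_J C :=
  germ_class (J_germBase C) (repr g).
have psiE p : psi (germ_class (Jbar_germBase C) p) =
    germ_class (J_germBase C) p.
  by apply/germ_classP; apply: Jbar_germ_eq_J hC _; exact: germ_eq_repr.
have phiE := @canonical_projectionE C.
split.
- by exists id; split=> //; move=> x.
- exists psi; split.
  + by move=> g; rewrite -(germ_class_repr g) phiE psiE.
  + by move=> g; rewrite -(germ_class_repr g) psiE phiE.
  + exact: (germ_map_continuous phiE).
  + exact: (germ_map_continuous psiE).
- by move=> g; rewrite -(germ_class_repr g) phiE /= !germ_sourceE.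
- by move=> g; rewrite -(germ_class_repr g) phiE /= !germ_rangeE.
- move=> chi /=; have [e chie] := Omega_nonzero chi.
  rewrite -(germ_unitE (J_germBase C) chie) phiE.
  exact: (germ_unitE (Jbar_germBase C)).
- move=> g h; rewrite -(germ_class_repr g) -(germ_class_repr h).
  rewrite /= germ_sourceE germ_rangeE => gh.
  by rewrite (germ_mulE _ gh) !phiE (germ_mulE _ gh).
Qed.
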